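(* Any four distinct events on a path form a chain; that is, they may be represented by the symbols $a,b,c,d$ in such a way that $(a,b,c,d)$ is a finite chain $[a\;b\;c\;d]$.
   Context: Let $\mathcal E$ be a set, whose elements are called events; let $\mathcal P$ be a set of subsets of $\mathcal E$, whose elements are called paths; and let $[\,\cdot\;\cdot\;\cdot\,]$ be a ternary relation (betweenness) on $\mathcal E$. Definitions. A finite chain $[q_0\;\dots\;q_n]$ is a sequence $(q_0,\dots,q_n)$ of events, $n\ge1$, such that: if $n=1$, then $q_0\ne q_1$ and some path contains both; if $n\ge2$, then $[q_i\;q_j\;q_k]$ for all $0\le i<j<k\le n$. An infinite chain is a sequence $(q_i)_{i\in\mathbb N}$ of events with $[q_i\;q_j\;q_k]$ for all $i<j<k$. A bound of an infinite chain is an event $q$ with $[q_i\;q_j\;q]$ for all $i<j$; a closest bound is a bound $q$ such that $[q_0\;q\;q']$ for every bound $q'\ne q$. For a path $Q$ and an event $b\notin Q$, the unreachable subset of $Q$ from $b$ is $Q(b,\emptyset)=\{x\in Q:\text{ no path contains both } b \text{ and } x\}$. For distinct paths $Q,R$ meeting at $x$ and $Q_a\in Q$, $Q(Q_a,R,x,\emptyset)=\{y: [x\;y\;Q_a]\text{ and there is } w\in R \text{ (}w\notin Q\text{) with } Q_a,y\in Q(w,\emptyset)\}$. $\mathrm{SPRAY}[x]$ is the set of paths containing the event $x$. Three distinct paths of $\mathrm{SPRAY}[x]$ are dependent if some path not in $\mathrm{SPRAY}[x]$ meets each of the three; then each is said to be dependent on the set of the other two. Inductively, a path $T$ is dependent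 on a set $S\subseteq\mathrm{SPRAY}[x]$ with $n\ge3$ elements if $T$ is dependent on a set of two paths $\{S_1,S_2\}$, each of which is dependent on some subset of $S$ with $n-1$ elements. A set of paths is dependent if it contains a path $P$ and a subset not containing $P$ on which $P$ is dependent (for some $x$); it is independent if it has no dependent subset. $\mathrm{SPRAY}[x]$ is a 3-SPRAY if it contains four distinct paths forming an independent set such that every path of $\mathrm{SPRAY}[x]$ is dependent on the set of these four. The following axioms are assumed. (I1) $\mathcal E\neq\emptyset$. (I2) For distinct events $a,b$ there are paths $R\ni a$, $S\ni b$ with $R\cap S\ne\emptyset$. (I3) For any two distinct events there is at most one path containing both. (I4) If $\mathcal E\ne\emptyset$, there is at least one 3-SPRAY. (O1) If $[a\;b\;c]$ then some path contains $a,b,c$. (O2) $[a\;b\;c]\Rightarrow[c\;b\;a]$. (O3) $[a\;b\;c]\Rightarrow a\neq c$. (O4) $[a\;b\;c]$ and $[b\;c\;d]$ imply $[a\;b\;d]$ (no distinctness of $a,d$ is assumed). (O5) If $a,b,c$ are distinct events of one path, then $[a\;b\;c]$ or $[b\;c\;a]$ or $[c\;a\;b]$. (O6) If $Q,R,S$ are distinct paths, $T$ is a path, $a\in Q\cap R$, $b\in Q\cap S$, $c\in R\cap S$, and there are $d\in S$ with $[b\;c\;d]$ and $e\in R$ with $[c\;e\;a]$ and $d,e\in T$, then there is $f\in T\cap Q$ belonging to a finite chain with first event $a$ and last event $b$, where $a,f,b$ are distinct. (I5) For any path $Q$ and event $b\notin Q$, the set $Q(b,\emptyset)$ contains at least two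 events. (I6) For any path $Q$, event $b\notin Q$ and distinct $Q_x,Q_z\in Q(b,\emptyset)$ there is a finite chain $(q_0,\dots,q_n)$ with $q_0=Q_x$, $q_n=Q_z$ such that for all $i\in\{1,\dots,n\}$: $q_i\in Q(b,\emptyset)$, and every event $y$ with $[q_{i-1}\;y\;q_i]$ lies in $Q(b,\emptyset)$. (I7) For any path $Q$, event $b\notin Q$, $Q_x\in Q\setminus Q(b,\emptyset)$ and $Q_y\in Q(b,\emptyset)$ there is a finite chain $(q_0,\dots,q_n)$ and $0<m<n$ with $q_0=Q_x$, $q_m=Q_y$ and $q_n\in Q\setminus Q(b,\emptyset)$. (S) If $Q,R,S$ are distinct paths with $x\in Q\cap R\cap S$, and $Q_a\in Q\setminus\{x\}$ satisfies $Q(Q_a,R,x,\emptyset)=Q(Q_a,S,x,\emptyset)$, then there is a map $\theta:\mathcal E\to\mathcal E$ such that $P\mapsto\theta(P)$ (direct image) is a bijection $\mathcal P\to\mathcal P$, $\theta(y)=y$ for all $y\in Q$, and $\theta(R)=S$. (C) Every infinite chain that has a bound has a closest bound. *)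

(* Defs.v *)
From mathcomp Require Import all_boot all_fingroup.
From mathcomp Require Import boolp classical_sets functions cardinality.

Set Implicit Arguments.
Unset Strict Implicit.
Unset Printing Implicit Defensive.

Local Open Scope classical_set_scope.
Local Open Scope card_scope.

Section Spacetime.
Variables (E : Type) (Path : set (set E)) (btw : E -> E -> E -> Prop).

Definition on_common_path (a b : E) : Prop :=
  exists2 R, Path R & R a /\ R b.

(* A finite sequence (q_0, ..., q_n) is a function on 'I_n.+1. *)
Definition finite_chain (n : nat) (q : 'I_n.+1 -> E) : Prop :=
  [/\ (1 <= n)%N,
      n = 1%N -> q ord0 <> q ord_max /\ on_common_path (q ord0) (q ord_max)
    & (2 <= n)%N -> forall i j k : 'I_n.+1,
        (i < j)%N -> (j < k)%N -> btw (q i) (q j) (q k)].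

Definition infinite_chain (q : nat -> E) : Prop :=
  forall i j k : nat, (i < j)%N -> (j < k)%N -> btw (q i) (q j) (q k).

Definition bound_of (q : nat -> E) (e : E) : Prop :=
  forall i j : nat, (i < j)%N -> btw (q i) (q j) e.

Definition closest_bound_of (q : nat -> E) (e : E) : Prop :=
  bound_of q e /\ forall e', bound_of q e' -> e' <> e -> btw (q 0%N) e e'.

(* Q(b, emptyset), intended for a path Q and an event b outside Q *)
Definition unreachable (Q : set E) (b : E) : set E :=
  [set x | Q x /\ ~ on_common_path b x].

(* Q(Qa, R, x, emptyset), intended for distinct paths Q and R meeting at x and Qa in Q *)
Definition unreachable_via (Q : set E) (Qa : E) (R : set E) (x : E) : set E :=
  [set y | btw x y Qa /\
           exists w, [/\ R w, ~ Q w, unreachable Q w Qa & unreachable Q w y]].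

Definition SPRAY (x : E) : set (set E) := [set R | Path R /\ R x].

Definition dependent_triple (x : E) (Q R S : set E) : Prop :=
  [/\ SPRAY x Q, SPRAY x R & SPRAY x S] /\
  [/\ Q <> R, Q <> S & R <> S] /\
  exists T, [/\ Path T, ~ SPRAY x T,
                T `&` Q !=set0, T `&` R !=set0 & T `&` S !=set0].

(* In dependent_on_more, n is the number of elements of S. *)
Inductive dependent_on (x : E) : set E -> set (set E) -> Prop :=
| dependent_on_two (T S1 S2 : set E) :
    dependent_triple x T S1 S2 -> dependent_on x T [set S1; S2]
| dependent_on_more (n : nat) (T S1 S2 : set E) (S A1 A2 : set (set E)) :
    (3 <= n)%N -> S `<=` SPRAY x -> S #= `I_n ->
    dependent_triple x T S1 S2 ->
    A1 `<=` S -> A1 #= `I_n.-1 -> dependent_on x S1 A1 ->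
    A2 `<=` S -> A2 #= `I_n.-1 -> dependent_on x S2 A2 ->
    dependent_on x T S.

Definition dependent_set (A : set (set E)) : Prop :=
  exists x P K, [/\ A P, K `<=` A, ~ K P & dependent_on x P K].

Definition independent_set (A : set (set E)) : Prop :=
  forall B, B `<=` A -> ~ dependent_set B.

Definition is_3SPRAY (x : E) : Prop :=
  exists A : set (set E),
    [/\ A `<=` SPRAY x, A #= `I_4, independent_set A
      & forall P, SPRAY x P -> dependent_on x P A].

Record spacetime_axioms : Prop := SpacetimeAxioms {
  ax_I1 : exists e : E, True;
  ax_I2 : forall a b : E, a <> b ->
    exists R S, [/\ Path R, Path S, R a, S b & R `&` S !=set0];
  ax_I3 : forall a b : E, a <> b -> forall R S, Path R -> Path S ->
    R a -> R b -> S a -> S b -> R = S;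
  ax_I4 : (exists e : E, True) -> exists x, is_3SPRAY x;
  ax_O1 : forall a b c, btw a b c ->
    exists2 Q, Path Q & [/\ Q a, Q b & Q c];
  ax_O2 : forall a b c, btw a b c -> btw c b a;
  ax_O3 : forall a b c, btw a b c -> a <> c;
  ax_O4 : forall a b c d, btw a b c -> btw b c d -> btw a b d;
  ax_O5 : forall Q a b c, Path Q -> Q a -> Q b -> Q c ->
    a <> b -> b <> c -> a <> c ->
    [\/ btw a b c, btw b c a | btw c a b];
  ax_O6 : forall Q R S T a b c d e,
    Path Q -> Path R -> Path S -> Q <> R -> Q <> S -> R <> S -> Path T ->
    Q a -> R a -> Q b -> S b -> R c -> S c ->
    S d -> btw b c d -> R e -> btw c e a -> T d -> T e ->
    exists f, [/\ T f, Q f, [/\ a <> f, f <> b & a <> b]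
      & exists n (q : 'I_n.+1 -> E),
          [/\ finite_chain q, q ord0 = a, q ord_max = b & exists i, q i = f]];
  ax_I5 : forall Q b, Path Q -> ~ Q b ->
    exists x y, [/\ unreachable Q b x, unreachable Q b y & x <> y];
  ax_I6 : forall Q b Qx Qz, Path Q -> ~ Q b ->
    unreachable Q b Qx -> unreachable Q b Qz -> Qx <> Qz ->
    exists n (q : 'I_n.+1 -> E),
      [/\ finite_chain q, q ord0 = Qx, q ord_max = Qz
        & forall i j : 'I_n.+1, j = i.+1 :> nat ->
            unreachable Q b (q j) /\
            forall y, btw (q i) y (q j) -> unreachable Q b y];
  ax_I7 : forall Q b Qx Qy, Path Q -> ~ Q b ->
    (Q `\` unreachable Q b) Qx -> unreachable Q b Qy ->
    exists n (q : 'I_n.+1 -> E) (m : 'I_n.+1),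
      [/\ finite_chain q, (0 < m < n)%N, q ord0 = Qx, q m = Qy
        & (Q `\` unreachable Q b) (q ord_max)];
  ax_S : forall Q R S x Qa,
    Path Q -> Path R -> Path S -> Q <> R -> Q <> S -> R <> S ->
    Q x -> R x -> S x -> Q Qa -> Qa <> x ->
    unreachable_via Q Qa R x = unreachable_via Q Qa S x ->
    exists theta : E -> E,
      [/\ set_bij Path Path (fun A : set E => theta @` A),
          forall y, Q y -> theta y = y
        & theta @` R = S];
  ax_C : forall q, infinite_chain q ->
    (exists e, bound_of q e) -> exists e, closest_bound_of q e
}.

End Spacetime.

(* Main.v *)
Require Import Defs.
From mathcomp Require Import all_boot all_fingroup.
From mathcomp Require Import boolp classical_sets functions cardinality.

(** The order axioms alone only leave one obstruction to arranging four events
    of a path in a chain: a star, i.e. an event [o] lying between any two of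
    three events [a], [b], [c]. To refute a star with, say, [[a b c]], choose
    a path [R] crossing at [o], an event [g] of [R] joined to [b] by a path [T]
    and an event [e] with [[o g e]]. Moving [a] and [c] away from [o] along the
    path (I7) makes them reachable from [e]. By O6, [T] then meets the segments
    [ea] and [ec]; since [b] lies between [a] and [c], [T] meets all
    three sides of the triangle [aec] internally, which O6 forbids. *)

Set Implicit Arguments.
Unset Strict Implicit.
Unset Printing Implicit Defensive.

Local Open Scope classical_set_scope.
Local Open Scope card_scope.

Section Order.
Variables (E : Type) (Path : set (set E)) (btw : E -> E -> E -> Prop).
Hypothesis ax : spacetime_axioms Path btw.

Implicit Types (Q R S T : set E) (a b c d e f g o x y z : E).

Local Notation joined := (on_common_path Path).

(** * Elementary consequences of the order axioms *)

Lemma btw_sym a b c : btw a b c -> btw c b a.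
Proof. exact: (ax_O2 ax). Qed.

Lemma btw_neq13 a b c : btw a b c -> a <> c.
Proof. exact: (ax_O3 ax). Qed.

Lemma btw_trans_l a b c d : btw a b c -> btw b c d -> btw a b d.
Proof. exact: (ax_O4 ax). Qed.

Lemma btw_trans_r a b c d : btw a b c -> btw b c d -> btw a c d.
Proof.
by move=> abc bcd; apply/btw_sym/(btw_trans_l (btw_sym bcd) (btw_sym abc)).
Qed.

(** O4 is applied with equal outer events: [a = b] would give [[c a a]] and [[a a c]], hence
    [[c a c]], against O3. *)
Lemma btw_neq12 a b c : btw a b c -> a <> b.
Proof.
move=> abc ab; rewrite -ab in abc.
exact: (btw_neq13 (btw_trans_l (btw_sym abc) abc)).
Qed.

Lemma btw_neq23 a b c : btw a b c -> b <> c.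
Proof. by move=> /btw_sym/btw_neq12/nesym. Qed.

Lemma btw_asym a b c : btw a b c -> ~ btw b c a.
Proof. by move=> abc bca; apply: (btw_neq13 (btw_trans_l abc bca)). Qed.

Lemma path_eq Q R a b : Path Q -> Path R -> a <> b ->
  Q a -> Q b -> R a -> R b -> Q = R.
Proof. by move=> PQ PR ab Qa Qb Ra Rb; apply: (ax_I3 ax ab). Qed.

Lemma btw_on12 Q a b c : Path Q -> btw a b c -> Q a -> Q b -> Q c.
Proof.
move=> PQ abc Qa Qb; have [R PR [Ra Rb Rc]] := ax_O1 ax abc.
by rewrite (path_eq PQ PR (btw_neq12 abc) Qa Qb Ra Rb).
Qed.

Lemma btw_on13 Q a b c : Path Q -> btw a b c -> Q a -> Q c -> Q b.
Proof.
move=> PQ abc Qa Qc; have [R PR [Ra Rb Rc]] := ax_O1 ax abc.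
by rewrite (path_eq PQ PR (btw_neq13 abc) Qa Qc Ra Rc).
Qed.

(** * Reachable events, crossing paths and prolongation *)

Lemma reachable_beyond Q e o y : Path Q -> ~ Q e -> Q o -> joined e o ->
  unreachable Path Q e y -> exists z, [/\ Q z, joined e z & btw o y z].
Proof.
move=> PQ nQe Qo eo ey.
(* The chain of I7 starts at [o], has [y] strictly inside and ends at a reachable event, so its last
   event serves as [z]. *)
have [|n [q [m [[_ _ chain] /andP[m_gt0 m_lt] <- <- [Qz z_reach]]]]] :=
  ax_I7 ax PQ nQe (Qx := o) _ ey.
  by split=> // -[_]; apply.
exists (q ord_max); split=> //.
  by apply: contrapT => ez; apply: z_reach.
by apply: chain => //; apply: leq_trans m_lt.
Qed.

Lemma second_reachable Q e o : Path Q -> ~ Q e -> Q o -> joined e o ->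
  exists z, [/\ Q z, joined e z & z <> o].
Proof.
move=> PQ nQe Qo eo; have [y [_ [ey _ _]]] := ax_I5 ax PQ nQe.
have [z [Qz ez oyz]] := reachable_beyond PQ nQe Qo eo ey.
by exists z; split=> //; apply/nesym/(btw_neq13 oyz).
Qed.

Lemma reachable_outward Q e o b : Path Q -> ~ Q e -> Q o -> joined e o ->
  Q b -> exists b', [/\ Q b', joined e b' & b' = b \/ btw o b b'].
Proof.
move=> PQ nQe Qo eo Qb; have [eb|neb] := pselect (joined e b).
  by exists b; split=> //; left.
have [b' [Qb' eb' obb']] := reachable_beyond PQ nQe Qo eo (conj Qb neb).
by exists b'; split=> //; right.
Qed.

(** If [Q] held every event, a path missing some event would share with [Q] the two events of I5 and
    so equal [Q]. Then [Q] would be the only path, but a 3-SPRAY has four. *)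
Lemma exists_event_off Q : Path Q -> exists e, ~ Q e.
Proof.
move=> PQ; apply: contrapT => /forallNP allQ.
have {}allQ e : Q e by apply: contrapT (allQ e).
have [x [A [ASx A4 _ _]]] := ax_I4 ax (ax_I1 ax).
suff AQ : A `<=` [set Q].
  by move: (subset_card_le AQ); rewrite (card_le_eql A4) (card_le_eqr card_set1)
    card_le_II.
move=> P /ASx[PP _] /=; apply/seteqP; split=> [e _|e _]; first exact: allQ.
apply: contrapT => nPe; have [y [z [[Py _] [Pz _] yz]]] := ax_I5 ax PP nPe.
by apply: nPe; rewrite (path_eq PP PQ yz).
Qed.

Lemma exists_crossing Q a : Path Q -> Q a ->
  exists R, [/\ Path R, R a & R <> Q].
Proof.
move=> PQ Qa; have [e nQe] := exists_event_off PQ.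
have [|R [S [PR PS Ra Se [z [Rz Sz]]]]] := ax_I2 ax (a := a) (b := e).
  by move=> ae; apply: nQe; rewrite -ae.
have [RQ|RQ] := pselect (R = Q); last by exists R.
have SQ : S <> Q by move=> SQ; apply: nQe; rewrite -SQ.
have [Sa|nSa] := pselect (S a); first by exists S.
(* Now [S] meets [Q] at [z] and misses [a]. A second event [w] of [S] joined to [a] gives the
   crossing path, since [S] cannot share both [z] and [w] with [Q]. *)
rewrite RQ in Rz.
have az : joined a z by exists Q.
have [w [Sw [U PU [Ua Uw]] wz]] := second_reachable PS nSa Sz az.
exists U; split=> // UQ; rewrite UQ in Uw.
by apply: SQ; apply: path_eq wz _ _ _ _.
Qed.

Lemma prolongation Q a b : Path Q -> Q a -> Q b -> a <> b ->
  exists c, btw a b c.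
Proof.
move=> PQ Qa Qb ab; have [R [PR Ra RQ]] := exists_crossing PQ Qa.
have nRb : ~ R b by move=> Rb; apply/RQ/(path_eq PR PQ ab).
have [e [_ [[Re be] _ _]]] := ax_I5 ax PR nRb.
have nQe : ~ Q e by move=> Qe; apply: be; exists Q.
have ea : joined e a by exists R.
(* Unreachability is symmetric: [e] is unreachable from [b] on [R], so [b] is unreachable from [e]
   on [Q], while [a] is reachable along [R]. *)
have eb : unreachable Path Q e b.
  by split=> // -[U PU [Ue Ub]]; apply: be; exists U.
by have [c [_ _]] := reachable_beyond PQ nQe Qa ea eb; exists c.
Qed.

(** * Transversals of triangles *)

Lemma pasch Q R S T a b c d e :
  Path Q -> Path R -> Path S -> Q <> R -> Q <> S -> R <> S -> Path T ->
  Q a -> R a -> Q b -> S b -> R c -> S c ->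
  btw b c d -> btw c e a -> T d -> T e ->
  exists f, [/\ T f, Q f & btw a f b].
Proof.
move=> PQ PR PS QR QS RS PT Qa Ra Qb Sb Rc Sc bcd cea Td Te.
have Sd := btw_on12 PS bcd Sb Sc.
have Re := btw_on13 PR cea Rc Ra.
have [f [Tf Qf [af fb ab] [n [q [[n_gt0 chain1 chain2] q0 qn [i qi]]]]]] :=
  ax_O6 ax PQ PR PS QR QS RS PT Qa Ra Qb Sb Rc Sc Sd bcd Re cea Td Te.
exists f; split=> //.
(* Since [f] differs from both ends of the chain, its index is interior; this also forces the chain
   to have at least three events. *)
have i_gt0 : (0 < i)%N.
  rewrite lt0n; apply/eqP => i0; apply: af.
  by rewrite -q0 -qi; congr q; apply: val_inj.
have i_lt : (i < n)%N.
  rewrite ltn_neqAle -ltnS ltn_ord andbT; apply/eqP => i_n; apply: fb.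
  by rewrite -qn -qi; congr q; apply: val_inj.
rewrite -q0 -qi -qn; apply: chain2 => //.
exact: leq_ltn_trans i_lt.
Qed.

(* O6 in the triangle [v y z], cut by the path [W] through [w1] and [x], puts
   [w2] between [v] and [z]. *)
Lemma no_inner_transversal_middle V1 V2 W T v w1 w2 x y z :
  Path V1 -> Path V2 -> Path W -> Path T ->
  V1 <> V2 -> V2 <> W -> V2 <> T -> V1 <> T ->
  V1 v -> V1 w1 -> V2 v -> V2 w2 -> W w1 -> W w2 ->
  btw v y w1 -> btw v z w2 -> W x -> T x -> T y -> T z ->
  ~ btw y x z.
Proof.
move=> PV1 PV2 PW PT V12 V2W V2T V1T V1v V1w1 V2v V2w2 Ww1 Ww2 vyw vzw Wx Tx
  Ty Tz yxz.
have V1y := btw_on13 PV1 vyw V1v V1w1.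
have V2z := btw_on13 PV2 vzw V2v V2w2.
have [f [Wf V2f zfv]] := pasch PV2 PT PV1 V2T (nesym V12) (nesym V1T) PW
  V2z Tz V2v V1v Ty V1y vyw yxz Ww1 Wx.
have fw : f = w2.
  by apply: contrapT => fw; apply/V2W/(path_eq PV2 PW fw).
by rewrite fw in zfv; apply: btw_asym vzw zfv.
Qed.

(** One of [x], [y], [z] lies between the other two on [T]. The vertex common to the sides of the
    two outer ones takes the role of [v] in [no_inner_transversal_middle]. *)
Lemma no_inner_transversal A B C T a b c x y z :
  Path A -> Path B -> Path C -> Path T ->
  A <> B -> A <> C -> B <> C -> T <> A -> T <> B -> T <> C ->
  B a -> C a -> A b -> C b -> A c -> B c ->
  btw b x c -> btw a y c -> btw a z b -> T x -> T y -> T z -> False.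
Proof.
move=> PA PB PC PT AB neqAC BC TA TB TC Ba Ca Ab Cb Ac Bc bxc ayc azb Tx Ty Tz.
have Ax := btw_on13 PA bxc Ab Ac.
have By := btw_on13 PB ayc Ba Bc.
have Cz := btw_on13 PC azb Ca Cb.
have xy : x <> y.
  move=> xy; rewrite -xy in By.
  by apply/AB/(path_eq PA PB (btw_neq23 bxc)).
have xz : x <> z.
  move=> xz; rewrite -xz in Cz.
  by apply/neqAC/(path_eq PA PC (btw_neq12 bxc)).
have yz : y <> z.
  move=> yz; rewrite -yz in Cz.
  by apply/BC/(path_eq PB PC (btw_neq12 ayc)).
have [xyz|yzx|zxy] := ax_O5 ax PT Tx Ty Tz xy yz xz.
- apply: (@no_inner_transversal_middle A C B T b c a y x z) xyz => //;
    by [apply: nesym | apply: btw_sym].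
- apply: (@no_inner_transversal_middle B A C T c a b z y x) yzx => //;
    by [apply: nesym | apply: btw_sym].
- apply: (@no_inner_transversal_middle C B A T a b c x z y) zxy => //;
    by [apply: nesym | apply: btw_sym].
Qed.

(** * Exclusion of stars *)

Lemma btw_outward_star a b c o a' :
  btw a o b -> btw a o c -> a' = a \/ btw o a a' ->
  [/\ btw a' o b, btw a' o c & btw a b c -> btw a' b c].
Proof.
move=> aob aoc [->//|oaa'].
have [boa coa] := (btw_sym aob, btw_sym aoc).
split=> [||abc].
- exact/btw_sym/(btw_trans_l boa).
- exact/btw_sym/(btw_trans_l coa).
- exact: btw_trans_r (btw_sym (btw_trans_r boa oaa')) abc.
Qed.

Lemma no_ordered_star a b c o :
  btw a o b -> btw b o c -> btw a o c -> ~ btw a b c.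
Proof.
move=> aob boc aoc abc.
have [Q PQ [Qa Qo Qb]] := ax_O1 ax aob.
have Qc := btw_on12 PQ abc Qa Qb.
have [R [PR Ro RQ]] := exists_crossing PQ Qo.
have ob := btw_neq23 aob.
have nRb : ~ R b by move=> Rb; apply/RQ/(path_eq PR PQ ob).
have bo : joined b o by exists Q.
have [g [Rg [T PT [Tb Tg]] go]] := second_reachable PR nRb Ro bo.
have nQg : ~ Q g by move=> Qg; apply/RQ/(path_eq PR PQ go).
have [e oge] := prolongation PR Ro Rg (nesym go).
have Re := btw_on12 PR oge Ro Rg.
have oe := btw_neq13 oge.
have nQe : ~ Q e by move=> Qe; apply/RQ/(path_eq PR PQ oe).
have eo : joined e o by exists R.
have [a' [Qa' [A PA [Ae Aa]] oa]] := reachable_outward PQ nQe Qo eo Qa.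
have [c' [Qc' [C PC [Ce Cc]] oc]] := reachable_outward PQ nQe Qo eo Qc.
have [{}aob {}aoc /(_ abc) {}abc] := btw_outward_star aob aoc oa.
have [{boc}cob {aoc}coa /(_ (btw_sym abc)) {abc}cba] :=
  btw_outward_star (btw_sym boc) (btw_sym aoc) oc.
have TQ : T <> Q by move=> TQ; apply: nQg; rewrite -TQ.
have AQ : A <> Q by move=> AQ; apply: nQe; rewrite -AQ.
have CQ : C <> Q by move=> CQ; apply: nQe; rewrite -CQ.
have AR : A <> R.
  move=> AR; rewrite AR in Aa.
  by apply/RQ/(path_eq PR PQ (btw_neq12 aob)).
have CR : C <> R.
  move=> CR; rewrite CR in Cc.
  by apply/RQ/(path_eq PR PQ (btw_neq12 cob)).
have neqAC : A <> C.
  move=> neqAC; rewrite neqAC in Aa.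
  by apply/CQ/(path_eq PC PQ (btw_neq13 cba)).
have TA : T <> A.
  move=> TA; rewrite TA in Tb.
  by apply/AQ/(path_eq PA PQ (btw_neq13 aob)).
have TC : T <> C.
  move=> TC; rewrite TC in Tb.
  by apply/CQ/(path_eq PC PQ (btw_neq13 cob)).
(* In the triangle [e], [a'], [o], the path [T] meets one side internally at [g] and another,
   extended beyond [o], at [b]; so it meets the side from [e] to [a']. The same holds with [c']. *)
have [f [Tf Af efa]] := pasch PA PR PQ AR AQ RQ PT Ae Re Aa Qa' Ro Qo
  aob oge Tb Tg.
have [h [Th Ch ehc]] := pasch PC PR PQ CR CQ RQ PT Ce Re Cc Qc' Ro Qo
  cob oge Tb Tg.
exact: (no_inner_transversal PQ PC PA PT (nesym CQ) (nesym AQ) (nesym neqAC) TQ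
  TC TA Ce Ae Qa' Aa Qc' Cc (btw_sym cba) ehc efa).
Qed.

Lemma no_star a b c o : btw a o b -> btw b o c -> ~ btw a o c.
Proof.
move=> aob boc aoc; have [Q PQ [Qa Qo Qb]] := ax_O1 ax aob.
have Qc := btw_on12 PQ aoc Qa Qo.
have [boa cob coa] := And3 (btw_sym aob) (btw_sym boc) (btw_sym aoc).
have [abc|bca|cab] := ax_O5 ax PQ Qa Qb Qc (btw_neq13 aob) (btw_neq13 boc)
  (btw_neq13 aoc).
- exact: no_ordered_star aob boc aoc abc.
- exact: no_ordered_star boc coa boa bca.
- exact: no_ordered_star coa aob cob cab.
Qed.

(** * Arranging four events in a chain *)

Section FourEvents.
Variables (Q : set E) (PQ : Path Q) (x : 'I_4 -> E).
Hypotheses (x_inj : injective x) (x_on : forall i, Q (x i)).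
Implicit Types i j k l : 'I_4.

Local Notation chainable :=
  (exists s : 'S_4, finite_chain Path btw (fun i : 'I_4 => x (s i))).

Lemma chainable_seq i j k l :
  btw (x i) (x j) (x k) -> btw (x j) (x k) (x l) -> chainable.
Proof.
move=> ijk jkl.
have ijl := btw_trans_l ijk jkl; have ikl := btw_trans_r ijk jkl.
have x_neq i1 i2 : x i1 <> x i2 -> i1 != i2.
  by move=> neq; apply/eqP => eqi; apply: neq; rewrite eqi.
pose s := [:: i; j; k; l].
have s_uniq : uniq s.
  rewrite /= !inE !negb_or !andbT.
  by rewrite (x_neq _ _ (btw_neq12 ijk)) (x_neq _ _ (btw_neq13 ijk))
    (x_neq _ _ (btw_neq13 ijl)) (x_neq _ _ (btw_neq12 jkl))
    (x_neq _ _ (btw_neq13 jkl)) (x_neq _ _ (btw_neq23 jkl)).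
have s_inj : injective (fun m : 'I_4 => nth i s m).
  by move=> m n /eqP; rewrite nth_uniq // => /eqP/val_inj.
exists (perm s_inj); split=> // _ m n p; rewrite !permE.
(* The four increasing index triples are [ijk], [ijl], [ikl] and [jkl]. *)
by case: m n p => [[|[|[|[|m]]]] ?] [[|[|[|[|n]]]] ?] [[|[|[|[|p]]]] ?].
Qed.

Lemma index_btw i j k : uniq [:: i; j; k] ->
  [\/ btw (x i) (x j) (x k), btw (x j) (x k) (x i) | btw (x k) (x i) (x j)].
Proof.
rewrite /= !inE negb_or andbT => /andP[/andP[/eqP ij /eqP ik] /eqP jk].
by apply: (ax_O5 ax PQ) => // /x_inj.
Qed.

(** Either order of [k] and [l] beyond [j] gives a chain; [j] between them would make a star centred
    at [x j]. *)
Lemma chainable_same_side i j k l : k != l ->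
  btw (x i) (x j) (x k) -> btw (x i) (x j) (x l) -> chainable.
Proof.
move=> /eqP kl ijk ijl.
have kl' : x k <> x l by move=> /x_inj.
have [jkl|klj|ljk] := ax_O5 ax PQ (x_on j) (x_on k) (x_on l) (btw_neq23 ijk)
  kl' (btw_neq23 ijl).
- exact: chainable_seq ijk jkl.
- exact: chainable_seq ijl (btw_sym klj).
- by have := no_star ijk (btw_sym ljk) ijl.
Qed.

(** Placing [l] relative to [j], [k], and if needed to [i], [j], always yields two triples that
    either overlap in consecutive events or, read suitably, start with the same two events. *)
Lemma chainable_extend i j k l : uniq [:: l; i; j; k] ->
  btw (x i) (x j) (x k) -> chainable.
Proof.
move=> uniq_lijk ijk.
have /= := uniq_lijk; rewrite !inE !negb_or !andbT.
move=> /and3P[/and3P[li lj lk] /andP[ij ik] jk].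
have [|jkl|klj|ljk] := @index_btw j k l.
- by rewrite /= !inE !negb_or jk /= !(eq_sym _ l) lj lk.
- exact: chainable_seq ijk jkl.
- have [|ijl|jli|lij] := @index_btw i j l.
  + by rewrite /= !inE !negb_or ij /= !(eq_sym _ l) lj li.
  + by apply: chainable_same_side ijk ijl; rewrite eq_sym.
  + by apply: chainable_same_side (btw_sym klj) jli; rewrite eq_sym.
  + exact: chainable_seq lij ijk.
- by apply: chainable_same_side (btw_sym ijk) (btw_sym ljk); rewrite eq_sym.
Qed.

Lemma four_events_chainable : chainable.
Proof.
by have [|||] := @index_btw (inord 0) (inord 1) (inord 2);
  [ | apply: (@chainable_extend _ _ _ (inord 3)) ..];
  rewrite /= !inE -!val_eqE /= !inordK.
Qed.

End FourEvents.
End Order.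

Theorem theorem9 (E : Type) (Path : set (set E)) (btw : E -> E -> E -> Prop)
    (axioms : spacetime_axioms Path btw)
    (Q : set E) (hQ : Path Q) (x : 'I_4 -> E)
    (x_distinct : injective x) (x_on_Q : forall i : 'I_4, Q (x i)) :
  exists s : 'S_4, finite_chain Path btw (fun i : 'I_4 => x (s i)).
Proof. exact (four_events_chainable axioms hQ x_distinct x_on_Q). Qed.
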